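(* Let $(W,S)$ be an odd-angled Coxeter system, let $S=S_1\sqcup\dots\sqcup S_k$ be the partition of $S$ into the vertex sets of the connected components of the divisibility diagram $\mathrm{Cox}_{\mathrm{div}}(W)$, and let $W_i$ be the subgroup of $W$ generated by $S_i$ (a Coxeter group with generating set $S_i$), so that $W=W_1*W_2*\dots*W_k$. Then $W$ contains a proper finite index reflection subgroup if and only if at least one of $W_1,\dots,W_k$ contains a proper finite index reflection subgroup.
   Context: A Coxeter system $(W,S)$ consists of a nonempty finite set $S=\{s_1,\dots,s_r\}$ and the group $W=\langle S\mid (s_is_j)^{m_{ij}}=1\ \forall i,j\rangle$, where $m_{ii}=1$ and $m_{ij}=m_{ji}\in\{2,3,4,\dots\}\cup\{\infty\}$ for $i\ne j$ ($m_{ij}=\infty$ means no relation is imposed on $s_is_j$). It is odd-angled if every $m_{ij}$ with $i\neq j$ is odd or infinite. A reflection of a Coxeter group is an element conjugate in it to one of its generators. A reflection subgroup is a proper subgroup (index greater than $1$) generated by reflections; the trivial subgroup counts as generated by the empty set of reflections. The divisibility diagram $\mathrm{Cox}_{\mathrm{div}}(W)$ is the graph with vertices $v_i$ corresponding to $s_i\in S$; distinct $v_i,v_j$ are joined by an edge labeled by the smallest divisor $k>1$ of $m_{ij}$ if $m_{ij}<\infty$, and are not joined if $m_{ij}=\infty$. *)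

(* Defs.v *)
From HB Require Import structures.
From mathcomp Require Import all_boot.
From mathcomp Require Import boolp classical_sets cardinality.

Set Implicit Arguments.
Unset Strict Implicit.
Unset Printing Implicit Defensive.

Local Open Scope classical_set_scope.
Local Open Scope group_scope.

Section Subgroups.
Variable W : groupType.
Implicit Types G H S : set W.

Definition subgroup H : Prop :=
  H 1 /\ forall x y, H x -> H y -> H (x / y).

Definition generated S : set W := smallest subgroup S.

(* Finiteness of the set of left cosets xH with x in G. *)
Definition finite_index G H : Prop :=
  finite_set [set [set x * h | h in H] | x in G].

(* Here S is the chosen Coxeter generating set of the group G; only
   conjugation by elements of G is allowed. *)
Definition reflections G S : set W :=
  [set x ^ g | x in S & g in G].

Definition reflection_subgroup G S H : Prop :=
  H `<` G /\ exists2 A : set W, A `<=` reflections G S & H = generated A.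

Definition has_finite_index_reflection_subgroup G S : Prop :=
  exists2 H : set W, reflection_subgroup G S H & finite_index G H.

End Subgroups.

Section Coxeter.
Variable r : nat.

(* The exponent "infinity" is encoded by None. *)
Definition coxeter_matrix (m : 'I_r -> 'I_r -> option nat) : Prop :=
  [/\ forall i, m i i = Some 1%N,
      forall i j, m i j = m j i &
      forall i j n, i != j -> m i j = Some n -> (2 <= n)%N].

Definition odd_angled (m : 'I_r -> 'I_r -> option nat) : Prop :=
  forall i j n, i != j -> m i j = Some n -> odd n.

Definition coxeter_relations (m : 'I_r -> 'I_r -> option nat)
    (G : groupType) (t : 'I_r -> G) : Prop :=
  forall i j n, m i j = Some n -> (t i * t j) ^+ n = 1.

(* W is the group presented by the generators s_i and the Coxeter relations:
   the s_i generate W and satisfy the relations, and every family satisfying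
   them in any group is the image of s under a group morphism from W. *)
Definition coxeter_system (m : 'I_r -> 'I_r -> option nat)
    (W : groupType) (s : 'I_r -> W) : Prop :=
  [/\ coxeter_matrix m,
      generated (range s) = setT,
      coxeter_relations m s &
      forall (G : groupType) (t : 'I_r -> G), coxeter_relations m t ->
        exists f : {multiplicative W -> G}, forall i, f (s i) = t i].

(* The divisibility diagram as an edge-labelled graph: None means "not joined".
   For n > 1, pdiv n is the smallest divisor of n greater than 1. *)
Definition div_diagram (m : 'I_r -> 'I_r -> option nat) (i j : 'I_r) :
    option nat :=
  if i == j then None else omap pdiv (m i j).

Definition div_adj (m : 'I_r -> 'I_r -> option nat) : rel 'I_r :=
  fun i j => isSome (div_diagram m i j).

Definition div_components (m : 'I_r -> 'I_r -> option nat) :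
    {set {set 'I_r}} :=
  equivalence_partition (connect (div_adj m)) [set: 'I_r]%SET.

End Coxeter.

(* Main.v *)
Require Import Defs.
From HB Require Import structures.
From mathcomp Require Import all_boot.
From mathcomp Require Import boolp classical_sets cardinality.

Local Open Scope classical_set_scope.

(** Write [W_C] for the subgroup generated by the [s i] with [i] in a component
    [C]. Everything rests on the fact that a finite entry [m i j] forces [i]
    and [j] into the same component, so that no defining relation mixes two
    components: group morphisms out of [W] may be prescribed independently on
    the generators in [C] and on the others.

    If [H] is a proper finite index reflection subgroup of [W_C], the morphism
    [W -> W_C] killing the generators outside [C] is a retraction, and the
    preimage of [H] is proper and of finite index. It is generated by
    reflections because the kernel is generated by the conjugates of the killed
    generators, and these are reflections ([retraction_reflection_subgroup]).

    Conversely let [H] be a proper finite index reflection subgroup of [W].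
    Some generator [s j] is not in [H]; let [C] be its component. Then
    [K = W_C `&` H] is proper and of finite index in [W_C], so it suffices that
    [K] is generated by reflections of [W_C]. This could be read off from the
    Kurosh subgroup theorem, but a covering argument avoids normal forms in
    free products. Let [R] be the subgroup generated by the reflections of
    [W_C] in [K]; it is normal in [K]. The [W_C]-orbit of the base point in
    [W / H] is [W_C / K], which is covered by [W_C / R] with fibre [K / R].
    Replace that orbit by its covering, and every other orbit, of [W_C] or of
    another component, by a trivial covering with the same fibre. Since
    relations do not mix components, these actions fit together into an action
    of [W] on a covering of [W / H]. By the choice of [R], a reflection that
    fixes a point of [W / H] fixes every point above it. As [H] is generated by
    reflections fixing the base point, [H] fixes the points above the base
    point, and in particular so does [K]; but the stabilizer in [W_C] of such a
    point is [R]. Hence [K = R] ([separated_reflection_subgroup]). *)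

Set Implicit Arguments.
Unset Strict Implicit.
Unset Printing Implicit Defensive.

Local Open Scope group_scope.

(** * Subgroups and cosets *)

Section SubgroupTheory.
Variable G : groupType.
Implicit Types (A B H K : set G) (x y g : G).

Lemma subgroupV H x : subgroup H -> H x -> H x^-1.
Proof. by move=> [H1 HF] Hx; rewrite -div1g; apply: HF. Qed.

Lemma subgroupM H x y : subgroup H -> H x -> H y -> H (x * y).
Proof.
by move=> sH Hx Hy; rewrite -[y]invgK; apply: sH.2 => //; apply: subgroupV.
Qed.

Lemma subgroupJ H x g : subgroup H -> H x -> H g -> H (x ^ g).
Proof.
move=> sH Hx Hg; rewrite conjgE.
by do !apply: subgroupM => //; apply: subgroupV.
Qed.

Lemma subgroupI H K : subgroup H -> subgroup K -> subgroup (H `&` K).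
Proof.
move=> sH sK; split; first by split; [apply: sH.1 | apply: sK.1].
by move=> x y [Hx Kx] [Hy Ky]; split; [apply: sH.2 | apply: sK.2].
Qed.

Lemma subgroup_preim (G' : groupType) (f : UMagmaMorphism.type G G')
    (H : set G') : subgroup H -> subgroup (f @^-1` H).
Proof.
move=> sH; split; first by rewrite /preimage /= gmulf1; apply: sH.1.
by move=> x y Hx Hy; rewrite /preimage /= gmulfF; apply: sH.2.
Qed.

Lemma generated_subgroup A : subgroup (generated A).
Proof.
split; first by move=> H [sH _]; apply: sH.1.
by move=> x y Ax Ay H sAH; apply: sAH.1.2; [apply: Ax | apply: Ay].
Qed.

Lemma generated_incl A : A `<=` generated A.
Proof. exact: sub_gen_smallest. Qed.

Lemma generated_sub A H : subgroup H -> A `<=` H -> generated A `<=` H.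
Proof. exact: smallest_sub. Qed.

Lemma generatedJ A g :
  (forall x, A x -> A (x ^ g)) ->
  forall x, generated A x -> generated A (x ^ g).
Proof.
move=> AJ x; apply: (@generated_sub _ [set y | generated A (y ^ g)]).
  have sA := generated_subgroup A; split=> /=.
    by rewrite conj1g; apply: sA.1.
  by move=> y z Ay Az; rewrite conjMg conjVg; apply: sA.2.
by move=> y Ay; apply: generated_incl; apply: AJ.
Qed.

Definition lcoset g A : set G := [set g * h | h in A].

Lemma lcosetE g A x : lcoset g A x = A (g^-1 * x).
Proof.
apply/propext; split; first by move=> [h Ah <-]; rewrite mulKg.
by move=> Ax; exists (g^-1 * x); rewrite ?mulVKg.
Qed.

Lemma lcosetM x y A : lcoset (x * y) A = lcoset x (lcoset y A).
Proof. by apply/funext => z; rewrite !lcosetE invgM mulgA. Qed.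

Lemma lcoset1 A : lcoset 1 A = A.
Proof. by apply/funext => z; rewrite lcosetE invg1 mul1g. Qed.

Lemma lcosetP H x : subgroup H -> lcoset x H = H <-> H x.
Proof.
move=> sH; split=> [eH | Hx].
  by rewrite -eH lcosetE mulVg; apply: sH.1.
apply/seteqP; split=> y; rewrite lcosetE => Hy.
  by rewrite -(mulVKg x y); apply: subgroupM.
by apply: subgroupM => //; apply: subgroupV.
Qed.

Lemma lcoset_eqP H x y : subgroup H -> lcoset x H = lcoset y H <-> H (x^-1 * y).
Proof.
move=> sH; rewrite -(lcosetP _ sH) lcosetM; split=> [<- | eH].
  by rewrite -lcosetM mulVg lcoset1.
by rewrite -{1}eH -lcosetM mulgV lcoset1.
Qed.

(** The cosets of [K `&` H] in [K] are the traces on [K] of cosets of [H]. *)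
Lemma finite_indexI H K : subgroup K ->
  finite_index [set: G] H -> finite_index K (K `&` H).
Proof.
move=> sK fH.
apply: (@sub_finite_set _ _ [set K `&` A | A in [set lcoset x H | x in setT]]);
  last exact: finite_image.
move=> _ [x Kx <-]; exists (lcoset x H); first by exists x.
rewrite -/(lcoset x (K `&` H)) -{1}((lcosetP _ sK).2 Kx).
by apply/funext => z; rewrite /setI /= !lcosetE.
Qed.

Lemma finite_index_preim (f : UMagmaMorphism.type G G) K H :
  (forall x, K (f x)) -> finite_index K H -> finite_index [set: G] (f @^-1` H).
Proof.
move=> Kf fH.
apply: (@sub_finite_set _ _ [set f @^-1` A | A in [set lcoset x H | x in K]]);
  last exact: finite_image.
move=> _ [x _ <-]; exists (lcoset (f x) H); first by exists (f x).
apply/funext => z; rewrite -/(lcoset x (f @^-1` H)) /preimage lcosetE /=.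
by rewrite lcosetE gmulfM gmulfV.
Qed.

End SubgroupTheory.

(** * The symmetric group of a type *)

Section Bijections.
Variable Y : Type.

(** Keeping the inverse as a component makes the group operations explicit; it
    is determined by the function, see [bijectionP]. *)
Record bijection := Bijection {
  bij_fun :> Y -> Y;
  bij_inv : Y -> Y;
  bij_funK : cancel bij_fun bij_inv;
  bij_invK : cancel bij_inv bij_fun }.

Implicit Types f g h : bijection.

Lemma bijectionP f g : (forall y, f y = g y) -> f = g.
Proof.
case: f g => [f f' fK f'K] [g g' gK g'K] /= /funext eq_fg.
case: g / eq_fg gK g'K => gK g'K.
have eq_fg' : f' = g' by apply/funext => y; rewrite -{1}(g'K y) fK.
case: g' / eq_fg' gK g'K => gK g'K.
by congr Bijection; apply: Prop_irrelevance.
Qed.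

Definition bij_one : bijection := @Bijection id id (frefl _) (frefl _).
Definition bij_mul f g : bijection :=
  Bijection (can_comp (bij_funK f) (bij_funK g))
            (can_comp (bij_invK g) (bij_invK f)).
Definition bij_opp f : bijection := Bijection (bij_invK f) (bij_funK f).

HB.instance Definition _ := gen_eqMixin bijection.
HB.instance Definition _ := gen_choiceMixin bijection.

Fact bij_mulA : associative bij_mul.
Proof. by move=> f g h; apply: bijectionP. Qed.
Fact bij_mul1 : left_id bij_one bij_mul.
Proof. by move=> f; apply: bijectionP. Qed.
Fact bij_mulr1 : right_id bij_one bij_mul.
Proof. by move=> f; apply: bijectionP. Qed.
Fact bij_mulV : left_inverse bij_one bij_opp bij_mul.
Proof. by move=> f; apply: bijectionP => y /=; rewrite bij_funK. Qed.
Fact bij_mulrV : right_inverse bij_one bij_opp bij_mul.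
Proof. by move=> f; apply: bijectionP => y /=; rewrite bij_invK. Qed.

HB.instance Definition _ :=
  isGroup.Build bijection bij_mulA bij_mul1 bij_mulr1 bij_mulV bij_mulrV.

Lemma bij1E y : (1 : bijection) y = y. Proof. by []. Qed.
Lemma bijME f g y : (f * g) y = f (g y). Proof. by []. Qed.

Lemma bij_fixV f y : f y = y -> f^-1 y = y.
Proof. by move=> {1}<-; apply: bij_funK. Qed.

Lemma subgroup_fix (G : groupType) (F : UMagmaMorphism.type G bijection) y :
  subgroup [set g | F g y = y].
Proof.
split=> [|g h /= Fg Fh]; first by rewrite /= gmulf1.
by rewrite gmulfF bijME bij_fixV.
Qed.

End Bijections.

(** * Covering an orbit of a subgroup *)

Section LiftedAction.
Variables (W : groupType) (P H : set W).
Hypotheses (sP : subgroup P) (sH : subgroup H).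
Implicit Types (x F : set W) (w : W).

(** [P] is to be the subgroup attached to one component, and the points of
    [W / H] are the cosets of [H], seen as subsets of [W]. *)
Definition base_orbit : set (set W) := [set lcoset w H | w in P].

Definition orbit_rep x : W := xget 1 [set w | P w /\ lcoset w H = x].

(** The cocycle with values in [P `&` H] expressing the action of [P] on itself
    in the trivialization of [P -> P / (P `&` H)] given by [orbit_rep]. *)
Definition transition w x : W := (orbit_rep (lcoset w x))^-1 * w * orbit_rep x.

(** Points above [x] are pairs [(x, F)]. When [b] holds, points above the base
    orbit are moved through the cocycle; otherwise [F] is left unchanged. *)
Definition lifted_act (b : bool) w (y : set W * set W) : set W * set W :=
  (lcoset w y.1,
   if b && `[< base_orbit y.1 >] then lcoset (transition w y.1) y.2 else y.2).

Lemma orbit_repP x : base_orbit x ->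
  P (orbit_rep x) /\ lcoset (orbit_rep x) H = x.
Proof.
move=> [w Pw eqx]; apply: (@xgetPex _ 1 [set w | P w /\ lcoset w H = x]).
by exists w.
Qed.

Lemma base_orbit_act w x : P w -> base_orbit (lcoset w x) <-> base_orbit x.
Proof.
have act v z : P v -> base_orbit z -> base_orbit (lcoset v z).
  by move=> Pv [u Pu <-]; exists (v * u); rewrite ?lcosetM//; apply: subgroupM.
move=> Pw; split; last exact: act.
by move=> /(act _ _ (subgroupV sP Pw)); rewrite -lcosetM mulVg lcoset1.
Qed.

Lemma transition_stab w x : P w -> base_orbit x -> (P `&` H) (transition w x).
Proof.
move=> Pw Ox; have [Px eqx] := orbit_repP Ox.
have [Pwx eqwx] := orbit_repP ((base_orbit_act _ Pw).2 Ox).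
split; first by do !apply: subgroupM => //; apply: subgroupV.
by rewrite /transition -mulgA -(lcoset_eqP _ _ sH) lcosetM eqx eqwx.
Qed.

Lemma lifted_act1 b y : lifted_act b 1 y = y.
Proof.
case: y => x F; rewrite /lifted_act /transition /= !lcoset1 mulg1 mulVg lcoset1.
by case: ifP.
Qed.

Lemma lifted_actM (b : bool) v w y : (b -> P w) ->
  lifted_act b (v * w) y = lifted_act b v (lifted_act b w y).
Proof.
case: y => x F Pw; rewrite /lifted_act /= lcosetM; congr pair.
case: b Pw => //= /(_ isT) Pw.
have -> : `[< base_orbit (lcoset w x) >] = `[< base_orbit x >].
  by apply/asbool_equiv_eq/base_orbit_act.
case: ifP => // _; rewrite -lcosetM; congr lcoset.
by rewrite /transition lcosetM !mulgA mulgK.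
Qed.

End LiftedAction.

(** * Coxeter generators with no relation to the others *)

Section Separated.
Variables (r : nat) (m : 'I_r -> 'I_r -> option nat).
Variables (W : groupType) (s : 'I_r -> W) (C : {set 'I_r}).
Hypothesis coxW : coxeter_system m s.

(** No finite entry of [m] relates an index in [C] to one outside: [W] is the
    free product of [<s i | i in C>] and [<s i | i notin C>]. *)
Hypothesis sepC : forall i j n, m i j = Some n -> (i \in C) = (j \in C).

Local Notation sC := (s @` [set` C]).
Local Notation WC := (generated sC).

Lemma WC_subgroup : subgroup WC.
Proof. exact: generated_subgroup. Qed.

Lemma WC_gen i : i \in C -> WC (s i).
Proof. by move=> iC; apply: generated_incl; exists i. Qed.

Lemma cox_ind (P : set W) : subgroup P -> (forall i, P (s i)) -> forall w, P w.
Proof.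
move=> sP Ps w; have [_ genW _ _] := coxW.
have: generated (range s) w by rewrite genW.
by apply: generated_sub => // _ [i _ <-].
Qed.

(** A multiplicative map only records compatibility with products; the theory of
    inverses and conjugates under a morphism needs the unit as well, which
    between groups is preserved for free. *)
Lemma cox_morphism (G : groupType) (t : 'I_r -> G) : coxeter_relations m t ->
  exists f : UMagmaMorphism.type W G, forall i, f (s i) = t i.
Proof.
have [_ _ _ univ] := coxW; move=> /univ[f fE].
have f1 : f 1 = 1 by apply: (@mulgI _ (f 1)); rewrite -gmulfM !mulg1.
pose f1M := Multiplicative_isUMagmaMorphism.Build W G f f1.
pose g : UMagmaMorphism.type W G := HB.pack (f : W -> G) f f1M.
by exists g.
Qed.

Lemma cox_sq i : s i * s i = 1.
Proof. by have [[mii _ _] _ rel _] := coxW; apply: (rel i i 1%N). Qed.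

Lemma reflectionsW : reflections WC sC `<=` reflections [set: W] (range s).
Proof. by move=> _ [_ [i iC <-]] [g _ <-]; exists (s i) => //; exists g. Qed.

Lemma reflections_in : reflections WC sC `<=` WC.
Proof.
move=> _ [_ [i iC <-]] [g gC <-].
by apply: subgroupJ (WC_gen iC) gC; apply: WC_subgroup.
Qed.

Lemma reflectionsJ x g :
  WC g -> reflections WC sC x -> reflections WC sC (x ^ g).
Proof.
move=> Wg [a Ca [h Wh <-]]; exists a => //.
exists (h * g); last by rewrite conjgM.
exact: (subgroupM WC_subgroup).
Qed.

(** The Coxeter relations survive when the generators outside [C] are killed,
    since each of them lives entirely inside or entirely outside [C]. *)
Lemma retraction_exists : exists f : UMagmaMorphism.type W W,
  forall i, f (s i) = if i \in C then s i else 1.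
Proof.
have [_ _ rel _] := coxW.
apply: (@cox_morphism W (fun i => if i \in C then s i else 1)) => i j n mij.
rewrite (sepC mij); case: ifP => _; first exact: rel.
by rewrite mulg1 expg1n.
Qed.

Lemma retraction_id (f : UMagmaMorphism.type W W) w :
  (forall i, f (s i) = if i \in C then s i else 1) -> WC w -> f w = w.
Proof.
move=> fE; apply: (@generated_sub _ _ [set w | f w = w]).
  split=> [|x y /= fx fy]; first exact: gmulf1.
  by rewrite gmulfF fx fy.
by move=> _ [i iC <-] /=; rewrite fE iC.
Qed.

(** The preimage of [H] under the retraction [f] is generated by [H] and the
    kernel of [f]. Instead of identifying the kernel, it is enough to see that
    [w / f w] lies in the group generated by the conjugates of the killed
    generators; this group is normal, so the property passes to products. *)
Lemma retraction_reflection_subgroup :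
  has_finite_index_reflection_subgroup WC sC ->
  has_finite_index_reflection_subgroup [set: W] (range s).
Proof.
move=> [H [[_ properH] [A Arefl HE]] fiH].
have sH : subgroup H by rewrite HE; apply: generated_subgroup.
have [f fE] := retraction_exists.
have fW w : WC (f w).
  apply: (@cox_ind (f @^-1` WC)) => [|i].
    by apply: subgroup_preim; apply: WC_subgroup.
  rewrite /preimage /= fE; case: ifP => [/WC_gen //|_].
  exact: WC_subgroup.1.
have sfH := subgroup_preim f sH.
pose killed := [set s i ^ g | i in [set i | i \notin C] & g in [set: W]].
have killed_refl : killed `<=` reflections [set: W] (range s).
  by move=> _ [i _ [g _ <-]]; exists (s i) => //; exists g.
exists (f @^-1` H); last exact: finite_index_preim fW fiH.
split.
  split; first by [].
  move=> HT; apply: properH => w Ww.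
  by rewrite -(retraction_id fE Ww); apply: HT.
exists (killed `|` A).
  by move=> x [/killed_refl //|/Arefl /reflectionsW].
have sK := generated_subgroup (killed `|` A).
apply/seteqP; split; last first.
  apply: generated_sub => // x [[i iC [g _ <-]]|Ax].
    rewrite /preimage /= gmulfJ fE (negbTE iC) conj1g; exact: sH.1.
  rewrite /preimage /= (retraction_id fE); last first.
    by apply: reflections_in; apply: Arefl.
  by rewrite HE; apply: generated_incl.
move=> w fHw; rewrite -(mulgVK (f w) w); apply: (subgroupM sK); last first.
  move: fHw; rewrite /preimage /= HE; apply: generated_sub => // x Ax.
  by apply: generated_incl; right.
suff: generated killed (w * (f w)^-1).
  by apply: generated_sub => // x kx; apply: generated_incl; left.
have sN := generated_subgroup killed.
have killedJ x g : generated killed x -> generated killed (x ^ g).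
  apply: generatedJ => {}x [i iC [h _ <-]].
  by exists i => //; exists (h * g) => //; rewrite conjgM.
apply: (@cox_ind [set w | generated killed (w / f w)]) => {w fHw} [|i].
  split=> [|x y /= Kx Ky]; first by rewrite /= gmulf1 divgg; apply: sN.1.
  (* (x / y) / f (x / y) is x / f x times a conjugate of f y / y *)
  have -> : (x / y) / f (x / y) =
      (x / f x) * ((y / f y)^-1 ^ (y / f x)).
    by rewrite gmulfF conjgE !invgM !invgK !mulgA !mulgVK.
  by apply: (subgroupM sN) => //; apply: killedJ; apply: (subgroupV sN).
rewrite /= fE; case: ifP => [_|/negbT iC]; first by rewrite divgg; apply: sN.1.
rewrite divg1; apply: generated_incl; exists i => //.
by exists 1; rewrite ?conjg1.
Qed.

Section Covering.
Variable H : set W.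
Hypothesis sH : subgroup H.

Local Notation act := (lifted_act WC H).

Lemma act_gen_invol i : involutive (act (i \in C) (s i)).
Proof.
move=> y; rewrite -lifted_actM; [|exact: WC_subgroup|exact: WC_gen].
by rewrite cox_sq lifted_act1.
Qed.

Definition gen_bij i : bijection (set W * set W) :=
  Bijection (@act_gen_invol i) (@act_gen_invol i).

(** The generators in [C] act through the cocycle and the others through the
    trivial covering. A relation between [s i] and [s j] only involves one of
    these two actions, so it holds because it holds in [W]. *)
Lemma lifted_action_exists :
  exists f : UMagmaMorphism.type W (bijection (set W * set W)),
  forall i y, f (s i) y = act (i \in C) (s i) y.
Proof.
have [_ _ rel _] := coxW.
have [|f fE] := @cox_morphism (bijection (set W * set W)) gen_bij; last first.
  by exists f => i y; rewrite fE.
move=> i j n mij.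
have sW := WC_subgroup.
have Wj : i \in C -> WC (s j) by rewrite (sepC mij); apply: WC_gen.
have Wij iC : WC (s i * s j) := subgroupM sW (WC_gen iC) (Wj iC).
have actX k y : ((gen_bij i * gen_bij j) ^+ k) y =
    act (i \in C) ((s i * s j) ^+ k) y.
  elim: k => [|k IHk] in y *; first by rewrite lifted_act1.
  rewrite !expgSr bijME IHk bijME /= -(sepC mij) (lifted_actM _ sW _ _ Wij).
  by rewrite (lifted_actM _ sW _ _ Wj).
by apply: bijectionP => y; rewrite actX (rel _ _ _ mij) lifted_act1.
Qed.

Variable f : UMagmaMorphism.type W (bijection (set W * set W)).
Hypothesis fE : forall i y, f (s i) y = act (i \in C) (s i) y.

Local Notation R := (generated (reflections WC sC `&` H)).

(** The fibre [(WC `&` H) / R] of the covering. *)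
Definition fibre : set (set W) := [set lcoset k R | k in WC `&` H].

(** Reflections of [WC] contained in [H] are permuted under conjugation by
    [WC `&` H], so the group they generate is normal there. *)
Lemma R_normal k : (WC `&` H) k -> forall x, R x -> R (x ^ k).
Proof.
move=> [Ck Hk]; apply: generatedJ => x [Cx Hx].
by split; [apply: reflectionsJ | apply: subgroupJ].
Qed.

Lemma lifted_fst w y : (f w y).1 = lcoset w y.1.
Proof.
move: w y; apply: cox_ind => [|i y]; last by rewrite fE.
split=> [y|v w IHv IHw y]; first by rewrite gmulf1 lcoset1.
rewrite gmulfF bijME IHv lcosetM; congr lcoset.
have := IHw ((f w)^-1 y); rewrite -bijME mulgV bij1E => ->.
by rewrite -lcosetM mulVg lcoset1.
Qed.

Lemma lifted_WC w y : WC w -> f w y = act true w y.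
Proof.
move=> Ww; have sW := WC_subgroup.
suff [_] : WC w /\ forall y, f w y = act true w y by apply.
apply: (@generated_sub _ sC [set w | WC w /\ forall y, f w y = act true w y])
  => // {w Ww y}; last first.
  by move=> _ [i iC <-]; split=> [|y]; rewrite ?fE ?iC//; apply: WC_gen.
split=> [|v w [Wv IHv] [Ww IHw]].
  by split=> [|y]; [apply: sW.1 | rewrite gmulf1 lifted_act1].
split=> [|y]; first exact: sW.2.
have Ww' := subgroupV sW Ww.
rewrite gmulfF bijME lifted_actM// IHv; congr (lifted_act _ _ _ _ _).
rewrite -[in RHS](bij_funK (f w) (act true w^-1 y)) -/((f w)^-1 _) IHw.
by rewrite -lifted_actM// mulgV lifted_act1.
Qed.

(** Stated as an equivalence because the elements [w] that merely send the
    invariant subset into itself need not be closed under inverses. *)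
Lemma lifted_fibre w y : fibre (f w y).2 <-> fibre y.2.
Proof.
have act_fibre i z : fibre z.2 -> fibre (act (i \in C) (s i) z).2.
  rewrite /lifted_act /=; case: ifP => // /andP[iC /asboolP Oz] [k Kk <-].
  exists (transition WC H (s i) z.1 * k); last by rewrite lcosetM.
  apply: subgroupM Kk; first exact: subgroupI WC_subgroup sH.
  by apply: transition_stab Oz; [exact: WC_subgroup | | exact: WC_gen].
move: w y; apply: cox_ind => [|i y]; last first.
  rewrite fE; split=> [/(act_fibre i)|]; last exact: act_fibre.
  by rewrite act_gen_invol.
split=> [y|v w IHv IHw y]; first by rewrite gmulf1.
by rewrite gmulfF bijME IHv -IHw -bijME mulgV.
Qed.

(** At a fixed point [x] of [s i] in the base orbit, the cocycle takes the value
    [s i ^ orbit_rep x]: a reflection of [WC] that lies in [H], hence an element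
    of [R]. As [R] is normal in [WC `&` H], it acts trivially on the fibre. *)
Lemma gen_fix i y :
  fibre y.2 -> lcoset (s i) y.1 = y.1 -> f (s i) y = y.
Proof.
case: y => x F /= [k Kk <-] fix_x; have sR := generated_subgroup.
rewrite fE /lifted_act /= fix_x; case: ifP => // /andP[iC /asboolP Ox].
congr pair; rewrite -lcosetM; apply/(lcoset_eqP _ _ (sR _ _)).
set c := transition _ _ _ _.
have [Wx _] := orbit_repP Ox.
have [_ Hc] := transition_stab WC_subgroup sH (WC_gen iC) Ox.
have cE : c = s i ^ orbit_rep WC H x by rewrite /c /transition fix_x -mulgA.
have Rc : R c.
  apply: generated_incl; split=> //; rewrite cE.
  exists (s i); first by exists i.
  by exists (orbit_rep WC H x).
by rewrite invgM -mulgA; apply: (R_normal Kk); apply: subgroupV (sR _ _) Rc.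
Qed.

(** A conjugate of a generator fixes [y] when that generator fixes a translate
    of [y], so the case of generators suffices. *)
Lemma reflection_fix t y :
  reflections [set: W] (range s) t -> fibre y.2 -> lcoset t y.1 = y.1 ->
  f t y = y.
Proof.
move=> [_ [i _ <-] [g _ <-]] Fy fix_y.
rewrite conjgE gmulfM gmulfM !bijME gen_fix.
- by rewrite -bijME -gmulfM mulVg gmulf1.
- exact/lifted_fibre.
rewrite lifted_fst -lcosetM -[in RHS]fix_y -lcosetM conjgE.
by rewrite mulVKg.
Qed.

(** All of [H] fixes the point [y = (H, R)] above the base point, while an
    element [w] of [WC] moves the second component of [y] by [w ^ c], where
    [c] represents the base point. Hence [w ^ c] is in [R] when [w] is in [H],
    and so is [w] by normality. *)
Lemma reflection_subgroup_inter : reflection_subgroup [set: W] (range s) H ->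
  WC `&` H = R.
Proof.
move=> [_ [A Arefl HE]]; have sW := WC_subgroup.
have sR := generated_subgroup (reflections WC sC `&` H).
apply/seteqP; split; last first.
  apply: generated_sub; first exact: subgroupI.
  by move=> x [/reflections_in].
move=> w [Ww Hw]; pose y := (H, R).
have Fy : fibre y.2.
  by exists 1; rewrite ?lcoset1//; split; [apply: sW.1 | apply: sH.1].
have fix_y : f w y = y.
  move: Hw; rewrite HE; apply: (@generated_sub _ _ [set w | f w y = y]).
    exact: subgroup_fix.
  move=> t At; apply: reflection_fix => //; first exact: Arefl.
  by apply/(lcosetP _ sH); rewrite HE; apply: generated_incl.
have OH : base_orbit WC H H by exists 1; [apply: sW.1 | rewrite lcoset1].
have [Pc eqc] := orbit_repP OH; move: fix_y.
have eqw : lcoset w H = H by apply/(lcosetP _ sH).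
rewrite lifted_WC// /lifted_act /= eqw (asboolT OH) => -[/lcosetP] /(_ sR).
rewrite /transition eqw -mulgA => Rw.
have Hc : H (orbit_rep WC H H) by apply/(lcosetP _ sH).
rewrite -(conjgK (orbit_rep WC H H) w); apply: R_normal Rw.
by split; [apply: (subgroupV sW Pc) | apply: (subgroupV sH Hc)].
Qed.

End Covering.

Lemma separated_reflection_subgroup i :
  i \in C -> forall H, reflection_subgroup [set: W] (range s) H -> ~ H (s i) ->
  finite_index [set: W] H -> has_finite_index_reflection_subgroup WC sC.
Proof.
move=> iC H rH Hi fiH; have sW := WC_subgroup.
have sH : subgroup H by case: rH => _ [A _ ->]; apply: generated_subgroup.
have [f fE] := lifted_action_exists H.
exists (WC `&` H); last exact: finite_indexI.
split.
  split; first by move=> x [].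
  by move=> /(_ _ (WC_gen iC))[].
exists (reflections WC sC `&` H); first by move=> x [].
exact: reflection_subgroup_inter fE rH.
Qed.

End Separated.

(** * Components of the divisibility diagram *)

Section Components.
Variables (r : nat) (m : 'I_r -> 'I_r -> option nat).
Hypothesis coxm : coxeter_matrix m.

Lemma div_components_separated (C : {set 'I_r}) i j n :
  C \in div_components m -> m i j = Some n -> (i \in C) = (j \in C).
Proof.
have [_ msym _] := coxm.
have [->//|neq_ij] := eqVneq i j.
move=> /imsetP[k _ ->] mij; rewrite !inE /=.
have adj_sym : symmetric (div_adj m).
  by move=> i' j'; rewrite /div_adj /div_diagram eq_sym msym.
apply: (same_connect_r (sym_connect_sym adj_sym)); apply: connect1.
by rewrite /div_adj /div_diagram (negbTE neq_ij) mij.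
Qed.

Lemma div_components_cover i : exists2 C, C \in div_components m & i \in C.
Proof.
exists [set j in [set: 'I_r]%SET | connect (div_adj m) i j]%SET.
  by apply/imsetP; exists i.
by rewrite !inE connect0.
Qed.

End Components.

Theorem lemma6p3 (r : nat) (m : 'I_r -> 'I_r -> option nat)
    (W : groupType) (s : 'I_r -> W)
    (r_gt0 : (0 < r)%N)
    (coxW : coxeter_system m s)
    (oddm : odd_angled m) :
  has_finite_index_reflection_subgroup [set: W] (range s) <->
  exists2 C : {set 'I_r}, C \in div_components m &
    has_finite_index_reflection_subgroup
      (generated (s @` [set` C])) (s @` [set` C]).
Proof.
have [coxm _ _ _] := coxW; split=> [[H rH fiH] | [C compC]]; last first.
  apply: (retraction_reflection_subgroup coxW) => i j n.
  exact: div_components_separated.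
have [i Hi] : exists i, ~ H (s i).
  apply/existsNP => Hs; case: rH => -[_ properH] [A _ HE].
  apply: properH => w _.
  by apply: (cox_ind coxW) => //; rewrite HE; apply: generated_subgroup.
have [C compC iC] := div_components_cover m i.
exists C => //; apply: (separated_reflection_subgroup coxW _ iC rH Hi fiH).
by move=> j k n; apply: div_components_separated.
Qed.
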